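(* In the setting of the context, suppose the regularity assumption and the local worst-case oracle assumption hold, and fix $x\in\mathcal X$ (write $\ell_k(z)=\ell_k(x,z)$) and $i\in[N]$. For any $b,b'\in\mathbb R_+$, $$|V_i(b)-V_i(b')|\le G_i|b-b'|^{1/p},$$ where $V_i(b)=\max_{1\le k_1<k_2\le K}V_i^{(k_1,k_2)}(b)$ is the local utility defined in the context and $G_i:=\max_{k\in[K]}\max\{\|\xi\|_*:\xi\in\partial\ell_k(\hat z_i)\}$.
   Context: Notation: $[n]=\{1,\dots,n\}$; $\mathcal P(\mathcal Z)$ is the set of Borel probability measures on $\mathcal Z$; $\|\cdot\|_*$ is the dual norm of the norm $\|\cdot\|$ below; $\partial\ell_k(\hat z_i)$ is the superdifferential of the concave function $\ell_k$ at $\hat z_i$. Setting. $\mathcal X\subseteq\mathbb R^n$, $\mathcal Z\subseteq\mathbb R^m$. A transportation cost $c:\mathcal Z\times\mathcal Z\to\mathbb R_+$ is lower semicontinuous, satisfies $c(z,z)=0$ for all $z$, and $c(\cdot,\hat z)$ is convex for every fixed $\hat z\in\mathcal Z$. The optimal transport discrepancy is $\mathrm{OT}_c(\mathbb P,\mathbb Q)=\min_{\gamma}\mathbb E_{(z,\hat z)\sim\gamma}[c(z,\hat z)]$ over couplings $\gamma$ of $\mathbb P$ and $\mathbb Q$. Given $\hat z_1,\dots,\hat z_N\in\mathcal Z$, let $\hat{\mathbb P}=\frac1N\sum_{i=1}^N\delta_{\hat z_i}$; given $\rho>0$, let $\mathcal P=\{\mathbb P\in\mathcal P(\mathcal Z):\mathrm{OT}_c(\mathbb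 P,\hat{\mathbb P})\le\rho\}$. Regularity assumption. (i) $\mathcal X$ is nonempty and convex; there exist $\mathbb Q_0\in\mathcal P$ and $x_0\in\mathcal X$ such that $x\mapsto\mathbb E_{z\sim\mathbb Q_0}[\ell(x,z)]$ is inf-compact on $\mathcal X$ (all sublevel sets are compact) and $\mathbb E_{z\sim\mathbb Q_0}[\ell(x_0,z)]>-\infty$; $\mathcal Z$ is nonempty, closed and convex. (ii) $\ell(x,z)=\max_{k\in[K]}\ell_k(x,z)$ with $K\ge2$, where each $\ell_k:\mathbb R^n\times\mathbb R^m\to\mathbb R$ is real-valued, convex in its first and concave in its second argument. (iii) There exist a norm $\|\cdot\|$ on $\mathbb R^m$ and $p\ge1$ with $c(z,\hat z)\ge\|z-\hat z\|^p$ for all $z,\hat z\in\mathcal Z$; moreover, if $p=1$, then for every $x\in\mathcal X$ there exist $g>0$, $\hat z_0\in\mathcal Z$ and $r\in[0,1)$ such that $\ell(x,z)\le g[1+\|z-\hat z_0\|^r]$ for all $z\in\mathcal Z$. Local worst-case oracle assumption. For any $k\in[K]$, $\hat z\in\mathcal Z$, radius $u\ge0$ and accuracy $\epsilon>0$ there is an algorithm that returns $\hat v\in\mathbb R^m$ with $\hat z+\hat v\in\mathcal Z$, $c(\hat z+\hat v,\hat z)\le u$, together with $\hat L=\ell_k(\hat z+\hat v)\ge\max\{\ell_k(\hat z+v):v\in\mathbb R^m,\hat z+v\in\mathcal Z,c(\hat z+v,\hat z)\le u\}-\epsilon$. Local utilities. $V_i^{(k_1,k_2)}(b)$ is the maximum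 of $\alpha_1\ell_{k_1}(\hat z_i+v_1)+\alpha_2\ell_{k_2}(\hat z_i+v_2)$ over $\alpha_j,\beta_j\in\mathbb R_+$, $v_j\in\mathbb R^m$ with $\hat z_i+v_j\in\mathcal Z$, $\alpha_jc(\hat z_i+v_j,\hat z_i)\le\beta_j$ ($j=1,2$), $\alpha_1+\alpha_2=1$, $\beta_1+\beta_2=b$. *)

(* Defs.v *)
From HB Require Import structures.
From mathcomp Require Import all_boot all_order all_algebra.
From mathcomp Require Import all_classical all_reals all_analysis.

Set Implicit Arguments.
Unset Strict Implicit.
Unset Printing Implicit Defensive.
Import Order.TTheory GRing.Theory Num.Theory.
Import numFieldNormedType.Exports.

Local Open Scope classical_set_scope.
Local Open Scope ring_scope.

Section euclidean.
Context {R : realType} {m : nat}.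
Local Notation E := 'rV[R]_m.

Definition is_norm (nrm : E -> R) : Prop :=
  [/\ forall u v, nrm (u + v) <= nrm u + nrm v,
      forall (a : R) v, nrm (a *: v) = `|a| * nrm v
    & forall v, nrm v = 0 -> v = 0].

Definition dotv (u v : E) : R := \sum_(j < m) u ord0 j * v ord0 j.

Definition dual_norm (nrm : E -> R) (xi : E) : \bar R :=
  ereal_sup [set (dotv xi v)%:E | v in [set v | nrm v <= 1]].

Definition concave_function (f : E -> R) : Prop :=
  convex_function setT (fun z => - f z).

Definition superdifferential (f : E -> R) (z0 : E) : set E :=
  [set xi | forall z, f z <= f z0 + dotv xi (z - z0)].

(* R^m with its Borel sigma-algebra. *)
Definition borel_rV := g_sigma_algebraType (@open E).

End euclidean.
Arguments borel_rV R m : clear implicits.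

Section optimal_transport.
Context {R : realType} {m : nat}.
Local Notation E := 'rV[R]_m.
Implicit Types (Z : set E) (c : E -> E -> R).

(* The cost is a function on Z x Z: its values outside Z x Z are irrelevant,
   both here and in the integral defining OT. *)
Definition transportation_cost Z c : Prop :=
  [/\ forall z zh, Z z -> Z zh -> 0 <= c z zh,
      @lower_semicontinuous (subspace (Z `*` Z)) R (fun w => (c w.1 w.2)%:E),
      forall z, Z z -> c z z = 0
    & forall zh, Z zh -> convex_function Z (fun z => c z zh)].

Definition coupling (P Q : set (borel_rV R m) -> \bar R)
    (g : probability (borel_rV R m * borel_rV R m)%type R) : Prop :=
  forall B, measurable B -> g (B `*` setT) = P B /\ g (setT `*` B) = Q B.

Definition OT Z c (P Q : set (borel_rV R m) -> \bar R) : \bar R :=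
  ereal_inf [set (\int[g]_(w in Z `*` Z) (c w.1 w.2)%:E)%E |
    g in coupling P Q].

Definition empirical (N : nat) (zhat : 'I_N -> E) :
    set (borel_rV R m) -> \bar R :=
  fun B => ((N%:R^-1)%:E * \sum_(i < N) \d_(zhat i : borel_rV R m) B)%E.

(* Borel probability measures on the closed set Z are identified with the Borel
   probability measures on R^m that give mass 1 to Z. *)
Definition ambiguity_set Z c (N : nat) (zhat : 'I_N -> E) (rho : R) :
    set (probability (borel_rV R m) R) :=
  [set Q : probability (borel_rV R m) R |
    Q Z = 1%E /\ (OT Z c Q (empirical zhat) <= rho%:E)%E].

End optimal_transport.

Section regularity.
Context {R : realType} {n m K : nat}.
Local Notation E := 'rV[R]_m.
Variable ell : 'I_K -> 'rV[R]_n -> E -> R.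
Implicit Types (X : set 'rV[R]_n) (Z : set E) (c : E -> E -> R).

(* Extended-real valued so that -oo is a neutral element for the maximum;
   the value is real as soon as 0 < K. *)
Definition loss (x : 'rV[R]_n) (z : E) : \bar R :=
  \big[maxe/-oo%E]_(k < K) (ell k x z)%:E.

Definition expected_loss Z (Q : probability (borel_rV R m) R)
    (x : 'rV[R]_n) : \bar R :=
  (\int[Q]_(z in Z) loss x z)%E.

Definition regularity_domains X Z c (N : nat) (zhat : 'I_N -> E) (rho : R) :
    Prop :=
  [/\ X !=set0, convex_set X,
      exists Q0 x0, [/\ ambiguity_set Z c zhat rho Q0, X x0,
        forall a : R, compact (X `&` [set x | expected_loss Z Q0 x <= a%:E]%E)
        & (-oo < expected_loss Z Q0 x0)%E]
    & [/\ Z !=set0, closed Z & convex_set Z]].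

Definition regularity_loss : Prop :=
  [/\ (2 <= K)%N,
      forall k z, convex_function setT (fun x => ell k x z)
    & forall k x, concave_function (ell k x)].

Definition regularity_growth X Z c (nrm : E -> R) (p : R) : Prop :=
  [/\ is_norm nrm, 1 <= p,
      forall z zh, Z z -> Z zh -> nrm (z - zh) `^ p <= c z zh
    & p = 1 -> forall x, X x -> exists g zh0 r,
        [/\ 0 < g, Z zh0, 0 <= r < 1
          & forall z, Z z ->
              (loss x z <= (g * (1 + nrm (z - zh0) `^ r))%:E)%E]].

End regularity.

Section local_utility.
Context {R : realType} {m K : nat}.
Local Notation E := 'rV[R]_m.
Variables (Z : set E) (c : E -> E -> R) (f : 'I_K -> E -> R).

(* In this section f k stands for the function ell_k(x, .) with x fixed. *)

Definition local_maximum (k : 'I_K) (zh : E) (u : R) : \bar R :=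
  ereal_sup [set (f k (zh + w))%:E | w in
    [set w | Z (zh + w) /\ c (zh + w) zh <= u]].

Definition local_oracle : Prop :=
  forall (k : 'I_K) (zh : E) (u eps : R), Z zh -> 0 <= u -> 0 < eps ->
  exists (v : E) (L : R),
    [/\ Z (zh + v), c (zh + v) zh <= u, L = f k (zh + v)
      & (local_maximum k zh u - eps%:E <= L%:E)%E].

Definition pair_utility (zh : E) (k1 k2 : 'I_K) (b : R) : \bar R :=
  ereal_sup [set y | exists (a1 a2 b1 b2 : R) (v1 v2 : E),
    [/\ [/\ 0 <= a1, 0 <= a2, 0 <= b1 & 0 <= b2],
        Z (zh + v1) /\ Z (zh + v2),
        a1 * c (zh + v1) zh <= b1 /\ a2 * c (zh + v2) zh <= b2,
        a1 + a2 = 1 /\ b1 + b2 = b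
      & y = (a1 * f k1 (zh + v1) + a2 * f k2 (zh + v2))%:E]].

Definition utility (zh : E) (b : R) : \bar R :=
  \big[maxe/-oo%E]_(kk : 'I_K * 'I_K | (kk.1 < kk.2)%N)
    pair_utility zh kk.1 kk.2 b.

Definition Gconst (nrm : E -> R) (zh : E) : \bar R :=
  \big[maxe/-oo%E]_(k < K)
    ereal_sup [set dual_norm nrm xi | xi in superdifferential (f k) zh].

End local_utility.

(* Main.v *)
Require Import Defs.
From HB Require Import structures.
From mathcomp Require Import all_boot all_order all_algebra.
From mathcomp Require Import all_classical all_reals all_analysis.
From mathcomp Require Import ring lra.
Set Implicit Arguments.
Unset Strict Implicit.
Unset Printing Implicit Defensive.
Import Order.TTheory GRing.Theory Num.Theory.
Import numFieldNormedType.Exports.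
Local Open Scope classical_set_scope.
Local Open Scope ring_scope.

(* For b' < b put t = b'/b and replace each feasible displacement v_j for the
   budget b by t v_j.  Convexity of the cost makes this feasible for the budget
   b', and concavity of the losses, together with the bound
   l_k(zh + v) <= l_k(zh) + G |v| given by any supergradient at zh, shows that
   at most (1 - t) G (alpha_1 |v_1| + alpha_2 |v_2|) is lost.  By Jensen's
   inequality and |v|^p <= c(zh + v, zh), this sum of norms is at most b^(1/p),
   and (1 - t) b^(1/p) <= (b - b')^(1/p).  Supergradients are constructed one
   coordinate at a time as in the Hahn-Banach theorem, and the oracle provides
   the finiteness of V. *)

(** * Convexity and concavity with explicit real weights *)

Lemma convex_functionP {R : realType} {V : lmodType R} (D : set V) (f : V -> R) :
  convex_function D f ->
  forall (t : R) x y, D x -> D y -> 0 <= t <= 1 ->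
    f (t *: x + (1 - t) *: y) <= t * f x + (1 - t) * f y.
Proof.
move=> fD t x y /mem_set Dx /mem_set Dy /andP[t0 t1].
exact: (fD (Itv01 t0 t1) x y Dx Dy).
Qed.

Lemma convex_setP {R : realType} {V : lmodType R} (D : set V) :
  convex_set D ->
  forall (t : R) x y, D x -> D y -> 0 <= t <= 1 -> D (t *: x + (1 - t) *: y).
Proof.
move=> cD t x y /mem_set Dx /mem_set Dy /andP[t0 t1].
exact/set_mem/(cD x y (Itv01 t0 t1)).
Qed.

Lemma concave_functionP {R : realType} {m : nat} (f : 'rV[R]_m -> R) :
  concave_function f ->
  forall (t : R) x y, 0 <= t <= 1 ->
    t * f x + (1 - t) * f y <= f (t *: x + (1 - t) *: y).
Proof.
move=> cf t x y t01.
have := @convex_functionP R _ setT _ cf t x y Logic.I Logic.I t01.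
lra.
Qed.

(** * Shrinking a displacement: [z + t *: v] lies on the segment from [z] to [z + v] *)

Section scaling.
Context {R : realType} {m : nat}.
Local Notation E := 'rV[R]_m.
Implicit Types (z v : E) (t : R).

Lemma scale_convE z v t : z + t *: v = t *: (z + v) + (1 - t) *: z.
Proof. by rewrite scalerDr scalerBl scale1r [RHS]addrC addrA subrK. Qed.

Lemma convex_set_scale (Z : set E) z v t : convex_set Z ->
  Z z -> Z (z + v) -> 0 <= t <= 1 -> Z (z + t *: v).
Proof. by move=> cZ Zz Zv t01; rewrite scale_convE; exact: convex_setP. Qed.

Lemma cost_scale (Z : set E) (c : E -> E -> R) z v t :
  transportation_cost Z c -> Z z -> Z (z + v) -> 0 <= t <= 1 ->
  c (z + t *: v) z <= t * c (z + v) z.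
Proof.
move=> [_ _ c0 cc] Zz Zv t01; rewrite scale_convE.
have := convex_functionP (cc z Zz) Zv Zz t01.
by rewrite (c0 _ Zz) mulr0 addr0.
Qed.

Lemma concave_scale (f : E -> R) z v t : concave_function f -> 0 <= t <= 1 ->
  t * f (z + v) + (1 - t) * f z <= f (z + t *: v).
Proof. by move=> cf t01; rewrite scale_convE; exact: concave_functionP. Qed.

End scaling.

(** * Existence of supergradients of concave functions *)

Section supergradient.
Context {R : realType}.

(* The admissible slopes along e are those between the two families of
   difference quotients; concavity of f puts the first below the second. *)
Lemma affine_majorant_extend {V : lmodType R} (f L : V -> R) (W : set V)
    (e : V) :
  (forall (t : R) x y, 0 <= t <= 1 ->
     t * f x + (1 - t) * f y <= f (t *: x + (1 - t) *: y)) ->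
  W !=set0 ->
  (forall (t : R) x y, W x -> W y -> W (t *: x + (1 - t) *: y)) ->
  (forall (t : R) x y, L (t *: x + (1 - t) *: y) = t * L x + (1 - t) * L y) ->
  (forall w, W w -> f w <= L w) ->
  exists a, forall w (s : R), W w -> f (w + s *: e) <= L w + s * a.
Proof.
move=> cf [w0 Ww0] cW aL fL.
have cmp (s t : R) w w' : W w -> W w' -> 0 < s -> 0 < t ->
    (f (w + s *: e) - L w) / s <= (L w' - f (w' - t *: e)) / t.
  move=> Ww Ww' s0 t0; have st0 : 0 < s + t by rewrite addr_gt0.
  have th01 : 0 <= t / (s + t) <= 1.
    by rewrite ler_pdivrMr// mul1r lerDr !ltW// divr_gt0.
  (* With these weights the multiples of [e] cancel, so the combination stays in [W], where [L]
     majorizes [f]. *)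
  have := cf (t / (s + t)) (w + s *: e) (w' - t *: e) th01.
  have -> : t / (s + t) *: (w + s *: e) + (1 - t / (s + t)) *: (w' - t *: e) =
      t / (s + t) *: w + (1 - t / (s + t)) *: w'.
    rewrite !scalerDr scalerN !scalerA addrACA -scalerBl.
    rewrite (_ : _ * s - _ * t = 0) ?scale0r ?addr0//.
    by field; rewrite gt_eqF.
  move=> /le_trans/(_ (fL _ (cW (t / (s + t)) _ _ Ww Ww'))).
  rewrite ler_pdivrMr// [X in _ -> _ <= X]mulrAC ler_pdivlMr// aL.
  have -> : 1 - t / (s + t) = s / (s + t) by field; rewrite gt_eqF.
  rewrite ![_ / (s + t) * _]mulrAC -!mulrDl ler_pM2r ?invr_gt0//.
  lra.
pose A := [set (f (w.1 + w.2 *: e) - L w.1) / w.2 | w in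
  [set w : V * R | W w.1 /\ 0 < w.2]].
have A0 : A !=set0.
  by exists ((f (w0 + 1 *: e) - L w0) / 1); exists (w0, 1).
have ubA w t : W w -> 0 < t -> ubound A ((L w - f (w - t *: e)) / t).
  by move=> Ww t0 _ [[w' s]/= [Ww' s0] <-]; exact: cmp.
have supA : has_sup A.
  by split => //; exists ((L w0 - f (w0 - 1 *: e)) / 1); exact: ubA.
(* For [s < 0] the slope works as the least upper bound of [A], for [s > 0] as an upper bound. *)
exists (sup A) => w s Ww; have [s0|s0|->] := ltgtP s 0.
- have := @ge_sup _ _ _ A0 (ubA w (- s) Ww _).
  rewrite oppr_gt0 => /(_ s0).
  rewrite scaleNr opprK ler_pdivlMr ?oppr_gt0//; lra.
- have : (f (w + s *: e) - L w) / s <= sup A.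
    by apply: ub_le_sup; [exact: supA.2 | exists (w, s)].
  rewrite ler_pdivrMr//; lra.
- by rewrite scale0r mul0r !addr0; exact: fL.
Qed.

Context {m : nat}.
Local Notation E := 'rV[R]_m.

Lemma dotv_linear (xi u v : E) (s t : R) :
  dotv xi (s *: u + t *: v) = s * dotv xi u + t * dotv xi v.
Proof.
rewrite /dotv !mulr_sumr -big_split/=; apply: eq_bigr => j _.
by rewrite !mxE; ring.
Qed.

(** Induction on [j]: [xi] gives a majorant on the span of the first [j] coordinate vectors, and
    [affine_majorant_extend] supplies the slope along the next one. *)
Lemma superdifferential_nonempty (f : E -> R) (z0 : E) :
  concave_function f -> superdifferential f z0 !=set0.
Proof.
move=> /concave_functionP cf.
suff /(_ m)[xi xiP] : forall j, exists xi : E, forall z : E,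
    (forall i : 'I_m, (j <= i)%N -> z ord0 i = 0) ->
    f (z0 + z) <= f z0 + dotv xi z.
  exists xi => z; rewrite -[in f z](subrKC z0 z); apply: xiP => i.
  by rewrite leqNgt ltn_ord.
elim=> [|j [xi xiP]].
  exists 0 => z z_0; have -> : z = 0.
    by apply/rowP => i; rewrite z_0// mxE.
  by rewrite addr0 /dotv big1 ?addr0// => i _; rewrite mxE mul0r.
(* From [j = m] on the vanishing condition is vacuous, so the same [xi] serves. *)
have [jm|mj] := ltnP j m; last first.
  exists xi => z z_0; apply: xiP => i ji.
  by have := leq_ltn_trans (leq_trans mj ji) (ltn_ord i); rewrite ltnn.
pose J := Ordinal jm.
pose W := [set w : E | forall i : 'I_m, (j <= i)%N -> w ord0 i = 0].
have [|||||a aP] := @affine_majorant_extend _ (fun z => f (z0 + z))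
    (fun z => f z0 + dotv xi z) W (delta_mx ord0 J).
- move=> t x y t01; apply: le_trans (cf t _ _ t01) _.
  by rewrite !scalerDr addrACA -scalerDl subrKC scale1r.
- by exists 0 => i _; rewrite mxE.
- by move=> t x y Wx Wy i ji; rewrite !mxE Wx// Wy// !mulr0 addr0.
- by move=> t x y; rewrite dotv_linear; ring.
- by move=> w Ww; exact: xiP.
(* The old entry [J] of [xi] may be overwritten: [w], which is [z] without its coordinate [J], does
   not see it. *)
exists (\row_i (if i == J then a else xi ord0 i)) => z z_0.
pose w := z - z ord0 J *: delta_mx ord0 J.
have wE i : w ord0 i = if i == J then 0 else z ord0 i.
  rewrite !mxE eqxx/=; case: eqVneq => [->|_]; first by rewrite mulr1 subrr.
  by rewrite mulr0 subr0.
have Ww : W w.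
  move=> i ji; rewrite wE; case: eqVneq => // iJ; apply: z_0.
  by rewrite ltn_neqAle ji andbT eq_sym.
have := aP w (z ord0 J) Ww; rewrite subrK => /le_trans; apply.
rewrite -addrA lerD2l /dotv [leRHS](bigD1 J)//= (bigD1 J)//= wE mxE eqxx.
rewrite mulr0 add0r addrC mulrC lerD2l; apply: ler_sum => i iJ.
by rewrite wE !mxE (negbTE iJ).
Qed.

End supergradient.

(** * Pairing of a norm with its dual norm *)

Section dual_norm.
Context {R : realType} {m : nat}.
Local Notation E := 'rV[R]_m.
Variable nrm : E -> R.
Hypothesis nrmP : is_norm nrm.

Lemma is_norm0 : nrm 0 = 0.
Proof. by case: nrmP => _ nZ _; rewrite -(scale0r (0 : E)) nZ normr0 mul0r. Qed.

Lemma is_norm_ge0 v : 0 <= nrm v.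
Proof.
case: nrmP => nD nZ _; have := nD v (- v).
rewrite subrr is_norm0 -scaleN1r nZ normrN1 mul1r; lra.
Qed.

Lemma dual_norm_ge0 xi : (0 <= dual_norm nrm xi)%E.
Proof.
apply: ereal_sup_ubound; exists 0; first by rewrite /= is_norm0.
by rewrite /dotv big1// => i _; rewrite mxE mulr0.
Qed.

(** By homogeneity it suffices to normalize [v]. The real bound [g] avoids products with a possibly
    infinite dual norm. *)
Lemma dotv_le_dual_norm xi v (g : R) :
  (dual_norm nrm xi <= g%:E)%E -> dotv xi v <= g * nrm v.
Proof.
move=> xig; case: (nrmP) => _ nZ n0.
have dE s : dotv xi (s *: v) = s * dotv xi v.
  by rewrite -[s *: v]addr0 -[X in _ + X](scale0r v) dotv_linear mul0r addr0.
have [/n0 ->|v0] := eqVneq (nrm v) 0.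
  by rewrite is_norm0 mulr0 -(scale0r v) dE mul0r.
have v_gt0 : 0 < nrm v by rewrite lt_def v0 is_norm_ge0.
rewrite -ler_pdivrMr// mulrC -dE -lee_fin; apply: le_trans xig.
apply: ereal_sup_ubound; exists ((nrm v)^-1 *: v) => //=.
by rewrite nZ ger0_norm ?invr_ge0 ?is_norm_ge0// mulVf.
Qed.

End dual_norm.

(** * Power inequalities behind the exponent [1/p] *)

Section powR.
Context {R : realType}.

Lemma ler_powRV (x y p : R) : 0 < p -> 0 <= x -> 0 <= y ->
  x `^ p <= y -> x <= y `^ p^-1.
Proof.
move=> p0 x0 y0 xy; rewrite -[x]powRr1// -(mulfV (lt0r_neq0 p0)) powRrM.
by apply: ge0_ler_powR => //; rewrite ?invr_ge0 ?ltW// nnegrE ?powR_ge0.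
Qed.

(** The reason is [t^p <= t], from [t <= 1 <= p]. Applied to the weight [1 - b'/b] and [y = b], it
    produces the factor [(b - b')^(1/p)]. *)
Lemma ler_mul_powRV (s t y p : R) : 1 <= p -> 0 <= s -> 0 <= t <= 1 -> 0 <= y ->
  s `^ p <= y -> t * s <= (t * y) `^ p^-1.
Proof.
move=> p1 s0 /andP[t0 t1] y0 sy.
apply: ler_powRV; rewrite ?mulr_ge0//; first exact: lt_le_trans p1.
rewrite powRM// ler_pM ?powR_ge0//.
have [->|t_neq0] := eqVneq t 0.
  by rewrite powR0// gt_eqF// (lt_le_trans _ p1).
by apply: ge1r_powR => //; rewrite lt_def t_neq0 t0.
Qed.

Lemma powR_jensen (a1 a2 x1 x2 p : R) : 1 <= p -> 0 <= a1 -> 0 <= a2 ->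
  a1 + a2 = 1 -> 0 <= x1 -> 0 <= x2 ->
  (a1 * x1 + a2 * x2) `^ p <= a1 * x1 `^ p + a2 * x2 `^ p.
Proof.
move=> p1 a10 a20 a12 x10 x20; have -> : a2 = 1 - a1 by rewrite -a12 addrC addKr.
apply: (convex_functionP (convex_powR p1)) => /=; rewrite ?in_itv/= ?andbT//.
by rewrite a10 -a12 lerDl.
Qed.

End powR.

(** * Finiteness, monotonicity and Hölder estimate of the local utility *)

Section local_utility.
Context {R : realType} {m K : nat}.
Local Notation E := 'rV[R]_m.
Variables (Z : set E) (c : E -> E -> R) (f : 'I_K -> E -> R) (zh : E).
Hypotheses (cost : transportation_cost Z c) (cZ : convex_set Z) (Zzh : Z zh).
Hypothesis cf : forall k, concave_function (f k).
Implicit Types (b : R) (k : 'I_K).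

(* Shrinking v by its weight a moves the mass a at zh + v to a unit mass within
   cost b, at the price of the constant |f k zh|; hence the oracle value at
   radius b bounds the weighted loss for all weights at once. *)
Lemma weighted_loss_bounded b k : local_oracle Z c f -> 0 <= b ->
  exists M : R, forall (a : R) v, 0 <= a <= 1 -> Z (zh + v) ->
    a * c (zh + v) zh <= b -> a * f k (zh + v) <= M.
Proof.
(* Accuracy 1 is enough, as only finiteness is at stake. *)
move=> orc b0; have [v0 [L [_ _ _ HL]]] := orc k zh b 1 Zzh b0 ltr01.
exists (L + 1 + `|f k zh|) => a v a01 Zv ab.
have : ((f k (zh + a *: v))%:E <= (L + 1)%:E)%E.
  rewrite EFinD -leeBlDr//; apply: le_trans HL.
  apply: leeB => //; apply: ereal_sup_ubound; exists (a *: v) => //.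
  split; first exact: convex_set_scale.
  exact: le_trans (cost_scale cost Zzh Zv a01) ab.
rewrite lee_fin => /(le_trans (concave_scale _ _ (cf k) a01)).
have : - (1 - a) * f k zh <= `|f k zh|.
  apply: le_trans (ler_norm _) _; rewrite normrM normrN ler_piMl//.
  by move: a01 => /andP[? ?]; rewrite ger0_norm; lra.
lra.
Qed.

Lemma pair_utility_lty b k1 k2 : local_oracle Z c f -> 0 <= b ->
  (pair_utility Z c f zh k1 k2 b < +oo)%E.
Proof.
move=> orc b0.
have [M1 M1P] := weighted_loss_bounded k1 orc b0.
have [M2 M2P] := weighted_loss_bounded k2 orc b0.
apply: (@le_lt_trans _ _ (M1 + M2)%:E); last exact: ltry.
apply: ge_ereal_sup => y [a1 [a2 [b1 [b2 [v1 [v2 [[a10 a20 b10 b20]]]]]]]].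
move=> [Z1 Z2] [c1 c2] [a12 b12] ->; rewrite lee_fin lerD//.
- by apply: M1P => //; [apply/andP; split|]; lra.
- by apply: M2P => //; [apply/andP; split|]; lra.
Qed.

Lemma pair_utility_gtNy b k1 k2 : 0 <= b ->
  (-oo < pair_utility Z c f zh k1 k2 b)%E.
Proof.
move=> b0; apply: (@lt_le_trans _ _ (f k1 zh)%:E); first exact: ltNyr.
(* Zero displacements with all weight on [k1] are feasible because [c zh zh = 0]. *)
apply: ereal_sup_ubound; exists 1, 0, b, 0, 0, 0; rewrite !addr0.
have [_ _ c0 _] := cost.
by rewrite c0// !mul1r !mul0r addr0.
Qed.

Lemma utility_fin_num b : local_oracle Z c f -> (2 <= K)%N -> 0 <= b ->
  utility Z c f zh b \is a fin_num.
Proof.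
move=> orc K2 b0; rewrite fin_numElt; apply/andP; split.
  (* The indices 0 and 1 form an admissible pair, so the maximum exceeds its default [-oo]. *)
  pose k1 : 'I_K := Ordinal (ltnW K2); pose k2 : 'I_K := Ordinal K2.
  apply: lt_le_trans (pair_utility_gtNy k1 k2 b0) _.
  exact: (@le_bigmax_cond _ _ _ _ (k1, k2)).
by apply: bigmax_lt => // kk _; exact: pair_utility_lty.
Qed.

Lemma le_pair_utility k1 k2 b b' : b' <= b ->
  (pair_utility Z c f zh k1 k2 b' <= pair_utility Z c f zh k1 k2 b)%E.
Proof.
move=> bb; apply: ereal_sup_le => y [a1 [a2 [b1 [b2 [v1 [v2]]]]]].
move=> [[a10 a20 b10 b20] ZZ [c1 c2] [a12 b12] ->].
(* The surplus budget only loosens the first constraint. *)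
exists a1, a2, (b1 + (b - b')), b2, v1, v2; split => //.
- by split => //; lra.
- by split => //; lra.
- by split => //; lra.
Qed.

Lemma le_utility b b' : b' <= b ->
  (utility Z c f zh b' <= utility Z c f zh b)%E.
Proof. by move=> bb; apply: le_bigmax2 => kk _; exact: le_pair_utility. Qed.

Variables (nrm : E -> R) (p g : R).
Hypotheses (nrmP : is_norm nrm) (p1 : 1 <= p) (g0 : 0 <= g).
Hypothesis growth :
  forall z z', Z z -> Z z' -> nrm (z - z') `^ p <= c z z'.
Hypothesis lip : forall k v, f k (zh + v) <= f k zh + g * nrm v.

Lemma pair_utility_hoelder k1 k2 b b' : 0 <= b' -> b' < b ->
  (pair_utility Z c f zh k1 k2 b <=
   pair_utility Z c f zh k1 k2 b' + (g * (b - b') `^ p^-1)%:E)%E.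
Proof.
move=> b'0 b'b; have b0 : 0 < b by exact: le_lt_trans b'b.
apply: ge_ereal_sup => y [a1 [a2 [b1 [b2 [v1 [v2 [[a10 a20 b10 b20]]]]]]]].
move=> [Z1 Z2] [c1 c2] [a12 b12] ->.
pose t := b' / b.
have t01 : 0 <= t <= 1.
  by rewrite divr_ge0 ?(ltW b0)//= ler_pdivrMr// mul1r ltW.
have [t0 t1] := andP t01.
have tb : t * b = b' by rewrite divfK// gt_eqF.
pose s := a1 * nrm v1 + a2 * nrm v2.
have n1 := is_norm_ge0 nrmP v1; have n2 := is_norm_ge0 nrmP v2.
have s0 : 0 <= s by rewrite addr_ge0// mulr_ge0.
have sb : s `^ p <= b.
  apply: le_trans (powR_jensen p1 a10 a20 a12 n1 n2) _.
  have nc v : Z (zh + v) -> nrm v `^ p <= c (zh + v) zh.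
    by move=> Zv; have := growth Zv Zzh; rewrite addrAC subrr add0r.
  rewrite -b12 lerD//.
  - by apply: le_trans c1; rewrite ler_wpM2l// nc.
  - by apply: le_trans c2; rewrite ler_wpM2l// nc.
have ts : (1 - t) * s <= (b - b') `^ p^-1.
  have -> : b - b' = (1 - t) * b by rewrite mulrBl mul1r tb.
  by apply: ler_mul_powRV => //; [apply/andP; split; lra | exact: ltW].
(* Concavity limits the loss to [(1 - t) * (f k (zh + v) - f k zh)], which [lip] bounds. *)
have drop k v : f k (zh + v) <= f k (zh + t *: v) + (1 - t) * (g * nrm v).
  have := concave_scale zh v (cf k) t01.
  have : (1 - t) * (f k (zh + v) - f k zh) <= (1 - t) * (g * nrm v).
    by rewrite ler_wpM2l ?subr_ge0// lerBlDl lip.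
  lra.
apply: (@le_trans _ _
  ((a1 * f k1 (zh + t *: v1) + a2 * f k2 (zh + t *: v2))%:E +
   (g * (b - b') `^ p^-1)%:E)%E).
  rewrite -EFinD lee_fin.
  have := ler_wpM2l a10 (drop k1 v1).
  have := ler_wpM2l a20 (drop k2 v2).
  have := ler_wpM2l g0 ts; rewrite /s; lra.
rewrite leeD2r//; apply: ereal_sup_ubound.
have sc a bj v : 0 <= a -> Z (zh + v) -> a * c (zh + v) zh <= bj ->
    a * c (zh + t *: v) zh <= t * bj.
  move=> a0 Zv cb; apply: (@le_trans _ _ (a * (t * c (zh + v) zh))).
    by rewrite ler_wpM2l// (cost_scale cost).
  by rewrite mulrCA ler_wpM2l.
(* The weights stay; the shrunken budgets add up to [t * b = b']. *)
exists a1, a2, (t * b1), (t * b2), (t *: v1), (t *: v2); split => //.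
- by split => //; rewrite mulr_ge0.
- by split; exact: convex_set_scale.
- by split; exact: sc.
- by split => //; rewrite -mulrDr b12.
Qed.

(** The increment is the same for all pairs, so it passes through the maximum. *)
Lemma utility_hoelder b b' : 0 <= b' -> b' < b ->
  (utility Z c f zh b <= utility Z c f zh b' + (g * (b - b') `^ p^-1)%:E)%E.
Proof.
move=> b'0 b'b; apply: bigmax_le; first exact: leNye.
move=> kk kk12; apply: le_trans (pair_utility_hoelder _ _ b'0 b'b) _.
by rewrite leeD2r//; exact: (@le_bigmax_cond _ _ _ _ kk).
Qed.

End local_utility.

(** * The constant [G] as a bound on supergradient slopes *)

Section Gconst.
Context {R : realType} {m K : nat}.
Local Notation E := 'rV[R]_m.
Variables (f : 'I_K -> E -> R) (nrm : E -> R) (zh : E).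
Hypothesis nrmP : is_norm nrm.
Hypothesis cf : forall k, concave_function (f k).

Lemma dual_norm_le_Gconst k xi : superdifferential (f k) zh xi ->
  (dual_norm nrm xi <= Gconst f nrm zh)%E.
Proof.
move=> xiP; apply: (@le_trans _ _
  (ereal_sup [set dual_norm nrm xi | xi in superdifferential (f k) zh])).
  by apply: ereal_sup_ubound; exists xi.
exact: (@le_bigmax _ _ _ _ _ k).
Qed.

(** A supergradient exists, so the supremum is not the value [-oo] of an empty set. *)
Lemma Gconst_ge0 : (0 < K)%N -> (0 <= Gconst f nrm zh)%E.
Proof.
move=> K0; pose k := Ordinal K0.
have [xi xiP] := superdifferential_nonempty zh (cf k).
exact: le_trans (dual_norm_ge0 nrmP xi) (dual_norm_le_Gconst xiP).
Qed.

Lemma Gconst_lipschitz (g : R) k v : Gconst f nrm zh = g%:E ->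
  f k (zh + v) <= f k zh + g * nrm v.
Proof.
move=> Gg; have [xi xiP] := superdifferential_nonempty zh (cf k).
apply: le_trans (xiP _) _; rewrite addrAC subrr add0r lerD2l.
by apply: dotv_le_dual_norm => //; rewrite -Gg; exact: dual_norm_le_Gconst xiP.
Qed.

End Gconst.

Theorem lemma12 (R : realType) (n m K N : nat)
  (X : set 'rV[R]_n) (Z : set 'rV[R]_m)
  (c : 'rV[R]_m -> 'rV[R]_m -> R)
  (zhat : 'I_N -> 'rV[R]_m) (rho : R)
  (ell : 'I_K -> 'rV[R]_n -> 'rV[R]_m -> R)
  (nrm : 'rV[R]_m -> R) (p : R)
  (hc : transportation_cost Z c)
  (hzhat : forall j, Z (zhat j))
  (hrho : 0 < rho)
  (reg_i : regularity_domains ell X Z c zhat rho)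
  (reg_ii : regularity_loss ell)
  (reg_iii : regularity_growth ell X Z c nrm p)
  (x : 'rV[R]_n) (hx : X x)
  (horacle : local_oracle Z c (fun k => ell k x))
  (i : 'I_N) (b b' : R) (hb : 0 <= b) (hb' : 0 <= b') :
  let V := utility Z c (fun k => ell k x) (zhat i) in
  let G := Gconst (fun k => ell k x) nrm (zhat i) in
  (`|V b - V b'| <= G * (`|b - b'| `^ p^-1)%:E)%E.
Proof.
rewrite /=; set V := utility Z c _ _; set G := Gconst _ _ _.
have [_ _ _ [_ _ cZ]] := reg_i.
have [K2 _ cell] := reg_ii.
have [nrmP p1 growth _] := reg_iii.
have cf k : concave_function (ell k x) by exact: cell.
have Vfin r : 0 <= r -> V r \is a fin_num.
  by move=> r0; exact: utility_fin_num.
have G0 : (0 <= G)%E by apply: Gconst_ge0 => //; exact: ltnW.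
(* With the larger budget first, monotonicity of [V] removes the absolute value. *)
have main r r' : 0 <= r' -> r' < r ->
    (`|V r - V r'| <= G * (`|r - r'| `^ p^-1)%:E)%E.
  move=> r'0 r'r; have r0 : 0 <= r by exact/ltW/(le_lt_trans r'0).
  have rr0 : 0 < r - r' by rewrite subr_gt0.
  rewrite (gtr0_norm rr0).
  (* If [G = +oo], the right-hand side is [+oo] too, since its other factor is positive. *)
  case Gg : G G0 => [g| |] // G0; last first.
    by rewrite gt0_mulye ?leey// lte_fin powR_gt0.
  have VV : (V r' <= V r)%E by apply: le_utility; exact: ltW.
  rewrite gee0_abs ?sube_ge0 ?Vfin// leeBlDl ?Vfin// -EFinM.
  have lip k v : ell k x (zhat i + v) <= ell k x (zhat i) + g * nrm v.
    exact: (Gconst_lipschitz nrmP cf).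
  exact: (utility_hoelder hc cZ (hzhat i) cf nrmP p1 G0 growth lip).
have [bb'|bb'|->] := ltgtP b b'.
- rewrite distrC -abseN fin_num_oppeB ?Vfin// addeC; exact: main.
- exact: main.
- by rewrite subee ?Vfin// abse0 mule_ge0// lee_fin powR_ge0.
Qed.
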